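(* Let $d\ge 1$ be an integer and $\alpha\in(0,1)$, and set $$C_0:=\int_0^\infty e^{-r^3/3}\,dr=3^{-2/3}\Gamma(1/3).$$ There exist constants $c_0>0$ and $N_0\ge 1$ and, for every real number $N\ge N_0$, a function $g_N:Q_1\to\mathbb{R}$ and a smooth real-valued stationary solution $f_N$ of $$(\partial_t+v\cdot\nabla_x)f_N=\Delta_v f_N+g_N\qquad\text{in }Q_1,$$ with $\|g_N\|_{L^\infty(Q_1)}\le 1$ and $[g_N]_{C_v^\alpha(Q_1)}=0$, such that $$\|f_N\|_{L^\infty(Q_1)}\le C_0N^{-2/3},\qquad [D_v^2f_N]_{C_v^\alpha(Q_{1/2})}\ge c_0N^{\alpha/3}.$$ Consequently the velocity-only Schauder estimate is false: for every $\Lambda>1$ there is no constant $C=C(d,\alpha,\Lambda)$ such that every smooth solution $f$ in $Q_1$ of $$(\partial_t+v\cdot\nabla_x)f=\operatorname{tr}(a\,D_v^2 f)+c\,f+g$$ with $\Lambda^{-1}\mathrm{Id}\le a\le\Lambda\,\mathrm{Id}$, $|c|\le\Lambda$, $|g|\le\Lambda$ in $Q_1$ and $f,D_v^2f,a,c,g\in C_v^\alpha(Q_1)$ satisfies $$[D_v^2f]_{C_v^\alpha(Q_{1/2})}\le C\Big(1+[c]_{C_v^\alpha(Q_1)}+[a]_{C_v^\alpha(Q_1)}^{1+2/\alpha}\Big)\|f\|_{L^\infty(Q_1)}+C\Big(1+[a]_{C_v^\alpha(Q_1)}\Big)[g]_{C_v^\alpha(Q_1)}.$$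
   Context: Points are written $(t,x,v)\in\mathbb{R}\times\mathbb{R}^d\times\mathbb{R}^d$. For $r>0$, $B_r\subset\mathbb{R}^d$ is the ball of radius $r$ centered at the origin, and $Q_r=(-r^2,0]\times B_{r^3}\times B_r$. A stationary solution is one that does not depend on $t$. $D_v^2 f$ is the $d\times d$ Hessian matrix of $f$ in $v$, and $\Delta_v$ is the Laplacian in $v$. The coefficient $a$ is $d\times d$ matrix-valued and $c,g$ are real-valued functions of $(t,x,v)$; the matrix inequalities on $a$ are in the sense of quadratic forms. For a bounded function $h$ on a cylinder $Q$, the velocity Hölder seminorm is $$[h]_{C_v^\alpha(Q)}:=\sup_{\substack{(t,x,v),(t,x,v')\in Q\\ 0<|v-v'|<1/2}}\frac{|h(t,x,v)-h(t,x,v')|}{|v-v'|^\alpha}.$$ For matrix-valued $h$, $|\cdot|$ is the Frobenius norm $|M|=(\sum_{i,j}|M_{ij}|^2)^{1/2}$. $h\in C_v^\alpha(Q)$ means $h$ is bounded on $Q$ with $[h]_{C_v^\alpha(Q)}<\infty$. *)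

(* Defs.v *)
From HB Require Import structures.
From mathcomp Require Export all_boot all_order all_algebra.
From mathcomp Require Export all_classical all_reals all_analysis.

Set Implicit Arguments.
Unset Strict Implicit.
Unset Printing Implicit Defensive.

Import Order.TTheory GRing.Theory Num.Theory.
Export numFieldNormedType.Exports.

Local Open Scope classical_set_scope.
Local Open Scope ring_scope.

(* A point (t, x, v) is ((t, x), v).  The library norm on this product (and on
   'rV[R]_d) is the sup norm; it is used here only for the topology, for the
   derivatives and for the cubes in [null_set].  Distances are measured with
   [enorm]. *)
Definition phase (R : realType) (d : nat) : normedModType R :=
  (R * 'rV[R]_d * 'rV[R]_d)%type.

Definition time (R : realType) (d : nat) (z : phase R d) : R := z.1.1.
Definition pos (R : realType) (d : nat) (z : phase R d) : 'rV[R]_d := z.1.2.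
Definition vel (R : realType) (d : nat) (z : phase R d) : 'rV[R]_d := z.2.

(* Euclidean norm of a vector, Frobenius norm of a matrix. *)
Definition enorm (R : realType) (m n : nat) (A : 'M[R]_(m, n)) : R :=
  Num.sqrt (\sum_i \sum_j `|A i j| ^+ 2).

Definition cyl (R : realType) (d : nat) (r : R) : set (phase R d) :=
  [set z | [/\ - r ^+ 2 < time z <= 0,
               enorm (pos z) < r ^+ 3 & enorm (vel z) < r]].

(* Unit vectors in the directions x_i and v_i. *)
Definition ex (R : realType) (d : nat) (i : 'I_d) : phase R d :=
  (0, delta_mx 0 i, 0).
Definition ev (R : realType) (d : nat) (i : 'I_d) : phase R d :=
  (0, 0, delta_mx 0 i).

(* The t-derivative is taken from the past, so that it only involves values of
   f on the cylinder, including at its final time t = 0; for f smooth on the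
   cylinder it is the usual derivative at t < 0. *)
Definition dt (R : realType) (d : nat) (f : phase R d -> R) (z : phase R d) : R :=
  lim (h^-1 * (f (time z + h, pos z, vel z) - f z) @[h --> 0^'-]).

Definition transport (R : realType) (d : nat) (f : phase R d -> R)
    (z : phase R d) : R :=
  dt f z + \sum_(i < d) vel z 0 i * 'D_(@ex R d i) f z.

Definition hessv (R : realType) (d : nat) (f : phase R d -> R)
    (z : phase R d) : 'M[R]_d :=
  \matrix_(i, j) 'D_(@ev R d i) ('D_(@ev R d j) f) z.

Definition lapv (R : realType) (d : nat) (f : phase R d -> R)
    (z : phase R d) : R :=
  \sum_(i < d) 'D_(@ev R d i) ('D_(@ev R d i) f) z.

Fixpoint Ck_on (R : realType) (V : normedModType R) (U : set V) (k : nat)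
    (f : V -> R) : Prop :=
  (forall z, U z -> {for z, continuous f}) /\
  if k is k'.+1 then
    forall e : V, (forall z, U z -> derivable f z e) /\ Ck_on U k' ('D_e f)
  else True.

(* A cylinder is not open (it contains its final time), whence the smooth
   extension to an open neighbourhood. *)
Definition smooth_on (R : realType) (d : nat) (A : set (phase R d))
    (f : phase R d -> R) : Prop :=
  exists (U : set (phase R d)) (F : phase R d -> R),
    [/\ open U, A `<=` U, forall k, Ck_on U k F & {in A, F =1 f}].

Definition stationary_on (R : realType) (d : nat) (A : set (phase R d))
    (f : phase R d -> R) : Prop :=
  forall z w, A z -> A w -> pos z = pos w -> vel z = vel w -> f z = f w.

(* [nrm] is the norm of the values: the absolute value or [enorm]. *)
Definition holderv (R : realType) (d : nat) (V : zmodType) (nrm : V -> R)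
    (alpha : R) (Q : set (phase R d)) (h : phase R d -> V) : \bar R :=
  ereal_sup [set s | exists z w : phase R d,
    [/\ Q z, Q w, time z = time w, pos z = pos w &
        0 < enorm (vel z - vel w) < 2^-1 /\
        s = (nrm (h z - h w) / enorm (vel z - vel w) `^ alpha)%:E]].

Definition in_Cv (R : realType) (d : nat) (V : zmodType) (nrm : V -> R)
    (alpha : R) (Q : set (phase R d)) (h : phase R d -> V) : Prop :=
  (exists M : R, forall z, Q z -> nrm (h z) <= M) /\
  (holderv nrm alpha Q h < +oo)%E.

Notation holder_r := (holderv (fun y => `|y|)).
Notation holder_m := (holderv (@enorm _ _ _)).
Notation in_Cv_r := (in_Cv (fun y => `|y|)).
Notation in_Cv_m := (in_Cv (@enorm _ _ _)).

(* Lebesgue-null subsets of R^(1+d+d): the balls of [phase] are cubes, of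
   volume (2r)^(2d+1). *)
Definition null_set (R : realType) (d : nat) (A : set (phase R d)) : Prop :=
  forall e : R, 0 < e ->
  exists (c : nat -> phase R d) (r : nat -> R),
    [/\ forall k, 0 <= r k, A `<=` \bigcup_k ball (c k) (r k) &
        (\sum_(0 <= k <oo) ((2 * r k) ^+ (2 * d + 1))%:E <= e%:E)%E].

Definition Linfty (R : realType) (d : nat) (Q : set (phase R d))
    (h : phase R d -> R) : \bar R :=
  ereal_inf [set M%:E | M in
    [set M : R | 0 <= M /\ null_set [set z | Q z /\ M < `|h z|]]].

Definition mxle (R : realType) (d : nat) (A B : 'M[R]_d) : Prop :=
  forall xi : 'rV[R]_d, (xi *m A *m xi^T) 0 0 <= (xi *m B *m xi^T) 0 0.

Definition Gamma (R : realType) (s : R) : R :=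
  \int[@lebesgue_measure R]_(t in `]0, +oo[) (t `^ (s - 1) * expR (- t)).

Definition C0 (R : realType) : R :=
  \int[@lebesgue_measure R]_(r in `[0, +oo[) expR (- (r ^+ 3) / 3).

(* Main.v *)
Require Import Defs.
From mathcomp Require Import all_boot all_order all_algebra.
From mathcomp Require Import all_classical all_reals all_analysis.
From mathcomp Require Import measurable_realfun ring lra.

(** The counterexample oscillates in [x] and not in [v] through its source: the
    source is [cos (N x_1)], bounded by [1] and independent of [v], and the
    solution is
      [f (x, v) = \int_0^oo cos (N x_1 - N v_1 s) exp (- N^2 s^3 / 3) ds],
    the real part of [exp (i N x_1)] times the Airy-type profile that solves
    [F'' - i N v_1 F = - 1].  The equation holds because
    [- N v_1 sin (..) exp (..) + N^2 s^2 cos (..) exp (..)] is minus the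
    [s]-derivative of the integrand of [f], whose integral over the half-line is
    read off at [s = 0].

    Rescaling [s] by [N^(2/3)] gives
      [f = N^(-2/3) airy 0 (N x_1) (N^(1/3) v_1)],
    where [airy n a b = \int_0^oo s^n cos (a - b s) exp (- s^3 / 3) ds].  Hence
    [|f| <= N^(-2/3) C0], while the only nonzero entry of [D_v^2 f], at
    [(1, 1)], is [airy 2 (N x_1 + pi) (N^(1/3) v_1)]: it has size of order one
    but varies on the velocity scale [N^(-1/3)].  Comparing [v_1 = 0] with
    [v_1 = N^(-1/3)] at [x = 0] yields a Hoelder quotient
    [N^(alpha/3) (airy 2 pi 1 - airy 2 pi 0)], and the gap
    [airy 2 pi 1 - airy 2 pi 0 = \int_0^oo s^2 (1 - cos s) exp (- s^3 / 3) ds]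
    is positive ([airy2_gap], [holder_hessv_sol_ge]).

    Calculus on [airy] rests on the moments of [exp (- s^3 / 3)] being finite.
    The family [airy n (a + theta) b] is stable under differentiation, since
    differentiating in the direction [(p, q)] shifts [theta] by [pi / 2] and
    combines the moments [n] and [n + 1]; a second-order Taylor bound for the
    cosine, integrated against the weight, proves this ([airy_taylor1]), and
    smoothness of [f] follows by induction ([Ck_on_wave]).  The differential
    equation is [airy_ode].  The value of [C0] comes from the substitution
    [t = s^3 / 3], made on compact intervals exhausting the half-line because
    the density of [Gamma (1 / 3)] is singular at [0] ([C0_Gamma]).

    With [a] the identity matrix and [c = 0], all seminorms on the right-hand
    side of the velocity-only Schauder estimate vanish on this family, so that
    side is at most [|C| C0], whereas the left-hand side is unbounded in [N]
    ([not_velocity_schauder]). *)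

Set Implicit Arguments.
Unset Strict Implicit.
Unset Printing Implicit Defensive.

Import Order.TTheory GRing.Theory Num.Theory.
Import numFieldNormedType.Exports.
Local Open Scope classical_set_scope.
Local Open Scope ring_scope.

(** * First-order estimates for sine and cosine *)

Lemma is_derive_continuous (R : realType) (f df : R -> R) :
  (forall z : R, is_derive z 1 f (df z)) -> continuous f.
Proof.
by move=> fdf z; apply/differentiable_continuous/derivable1_diffP/ex_derive; exact: fdf.
Qed.

(** Mean value inequality; the derivative is only bounded on the ball of center
    [x] and radius [`|y - x|]. *)
Lemma mvt_norm_le (R : realType) (f df : R -> R) (K x y : R) :
  (forall z : R, is_derive z 1 f (df z)) ->
  (forall z, `|z - x| <= `|y - x| -> `|df z| <= K) ->
  `|f y - f x| <= K * `|y - x|.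
Proof.
move=> fdf dfK.
have cw a b : {within `[a, b], continuous f}.
  by apply: continuous_subspaceT => z; exact: (is_derive_continuous fdf).
have [xy|yx|->] := ltgtP x y.
- have [c + ->] := MVT xy (fun z _ => fdf z) (cw x y).
  rewrite in_itv /= => /andP[xc cy]; rewrite normrM ler_wpM2r// dfK//.
  by rewrite !ger0_norm; lra.
- have [c + e] := MVT yx (fun z _ => fdf z) (cw y x).
  rewrite in_itv /= => /andP[yc cx]; rewrite distrC e normrM (distrC y) ler_wpM2r// dfK//.
  by rewrite !ler0_norm; lra.
- by rewrite !subrr normr0 mulr0.
Qed.

Lemma cos_lipschitz (R : realType) (x y : R) : `|cos y - cos x| <= `|y - x|.
Proof.
rewrite -[leRHS]mul1r; apply: (@mvt_norm_le R cos (fun z => - sin z)) => z.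
by move=> _; rewrite normrN sin_max.
Qed.

Lemma sin_lipschitz (R : realType) (x y : R) : `|sin y - sin x| <= `|y - x|.
Proof.
rewrite -[leRHS]mul1r; apply: (@mvt_norm_le R sin cos) => z.
by move=> _; rewrite cos_max.
Qed.

Lemma cos_taylor1 (R : realType) (u k : R) :
  `|cos (u + k) - cos u + k * sin u| <= k ^+ 2.
Proof.
pose f z := cos z + z * sin u.
have -> : cos (u + k) - cos u + k * sin u = f (u + k) - f u by rewrite /f; ring.
have -> : k ^+ 2 = `|k| * `|u + k - u|.
  by rewrite addrAC subrr add0r -expr2 -normrX ger0_norm ?sqr_ge0.
apply: (@mvt_norm_le R f (fun z => sin u - sin z)) => z.
  rewrite /f; apply: is_derive_eq; rewrite /= /GRing.scale /=; ring.
by rewrite addrAC subrr add0r => h; rewrite (le_trans (sin_lipschitz _ _))// distrC.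
Qed.

(** * Integration of exponentially dominated functions *)

Section real_integrable.
Context (R : realType) (D : set (measurableTypeR R)) (mD : measurable D).
Notation mu := (@lebesgue_measure R).
Implicit Types (f g : R -> R).

Lemma integrable_scale f (c : R) : mu.-integrable D (EFin \o f) ->
  mu.-integrable D (EFin \o (fun s => c * f s)).
Proof.
move=> fi; have := integrableZl mD c fi; apply: eq_integrable => //.
Qed.

Lemma integrable_add f g : mu.-integrable D (EFin \o f) ->
  mu.-integrable D (EFin \o g) -> mu.-integrable D (EFin \o (fun s => f s + g s)).
Proof.
move=> fi gi.
have := integrableD mD fi gi; apply: eq_integrable => //.
Qed.

Lemma integrable_sub f g : mu.-integrable D (EFin \o f) ->
  mu.-integrable D (EFin \o g) -> mu.-integrable D (EFin \o (fun s => f s - g s)).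
Proof.
move=> fi gi.
have := integrableB mD fi gi; apply: eq_integrable => //.
Qed.
End real_integrable.

Lemma is_derive_expRN (R : realType) (s : R) :
  is_derive s 1 (fun x : R => expR (- x)) (- expR (- s)).
Proof. by apply: is_derive_eq; rewrite /= /GRing.scale /=; ring. Qed.

Lemma continuous_expRN (R : realType) : continuous (fun x : R => expR (- x)).
Proof. exact: (is_derive_continuous (@is_derive_expRN R)). Qed.

Lemma integral_expRN (R : realType) :
  (\int[@lebesgue_measure R]_(s in `[0%R, +oo[) (expR (- s))%:E = 1%:E)%E.
Proof.
rewrite (@ge0_continuous_FTC2y R _ (fun s => - expR (- s)) 0 0).
- by rewrite oppr0 expR0 -EFinB; congr EFin; rewrite opprK add0r.
- by move=> s _; exact: expR_ge0.
- by apply: continuous_subspaceT; exact: continuous_expRN.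
- by rewrite -[X in _ --> X]oppr0; apply: cvgN; exact: cvgr_expR.
- by move=> s _; apply: derivableN; apply: ex_derive; exact: is_derive_expRN.
- by apply: cvg_at_right_filter; apply: cvgN; exact: continuous_expRN.
- move=> s _; rewrite derive1E; apply: derive_val.
  by apply: is_derive_eq; rewrite /= /GRing.scale /=; ring.
Qed.

Lemma integrable_expRN (R : realType) :
  (@lebesgue_measure R).-integrable `[0, +oo[
    (EFin \o (fun s => expR (- s))).
Proof.
apply/integrableP; split.
  apply/measurable_EFinP; apply: measurable_funTS.
  apply: continuous_measurable_fun.
  exact: continuous_expRN.
rewrite (_ : integral _ _ _ = 1%:E)%E ?ltry// -integral_expRN.
by apply: eq_integral => s _ /=; rewrite ger0_norm ?expR_ge0.
Qed.

Lemma integrable_exp_dominated (R : realType) (f : R -> R) (K : R) :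
  continuous f -> (forall s, 0 <= s -> `|f s| <= K * expR (- s)) ->
  (@lebesgue_measure R).-integrable `[0, +oo[ (EFin \o f).
Proof.
move=> cf fK.
have iK : (@lebesgue_measure R).-integrable `[0, +oo[
    (fun s => K%:E * (EFin \o (fun s => expR (- s))) s)%E.
  by apply: integrableZl => //; exact: integrable_expRN.
apply: le_integrable iK => //.
- apply/measurable_EFinP; apply: measurable_funTS.
  exact: continuous_measurable_fun.
- move=> s /=; rewrite in_itv /= andbT => s0.
  by rewrite lee_fin (le_trans (fK _ s0))// ler_norm.
Qed.

(** Fundamental theorem of calculus on the half-line for an integrand without a
    sign: adding [K exp (- s)], whose primitive is explicit, makes it
    nonnegative. *)
Lemma Rintegral_exp_dominated_FTC2y (R : realType) (f F : R -> R) (K : R) :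
  continuous f -> (forall s, 0 <= s -> `|f s| <= K * expR (- s)) ->
  (forall s : R, is_derive s 1 F (f s)) -> F s @[s --> +oo] --> 0 ->
  \int[@lebesgue_measure R]_(s in `[0, +oo[) f s = - F 0.
Proof.
move=> cf fK dF Foo.
pose G s := F s + - K * expR (- s).
pose g s := f s + K * expR (- s).
have dG (s : R) : is_derive s 1 G (g s).
  have dFs := dF s.
  by rewrite /G /g; apply: is_derive_eq; rewrite /= /GRing.scale /=; ring.
have cKe : continuous (fun s : R => K * expR (- s)).
  by move=> s; apply: cvgM; [exact: cvg_cst|exact: continuous_expRN].
have iKe : (@lebesgue_measure R).-integrable `[0, +oo[
    (EFin \o (fun s => K * expR (- s))).
  apply: (@integrable_exp_dominated R _ `|K|) => // s s0.
  by rewrite normrM (ger0_norm (expR_ge0 _)).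
have IG : \int[@lebesgue_measure R]_(s in `[0, +oo[) g s = 0 - G 0.
  apply: Rintegral_ge0_continuous_FTC2y.
  - move=> s s0; rewrite /g; have := fK _ s0; rewrite ler_norml => /andP[+ _].
    by lra.
  - by apply: continuous_subspaceT => s; apply: cvgD; [exact: cf|exact: cKe].
  - rewrite -[X in _ --> X](addr0 0) -[X in _ --> _ + X](mulr0 (- K)).
    by apply: cvgD => //; apply: cvgM; [exact: cvg_cst|exact: cvgr_expR].
  - by move=> s _; apply: ex_derive; exact: dG.
  - by apply: cvg_at_right_filter; exact: (is_derive_continuous dG).
  - by move=> s _; rewrite derive1E; apply: derive_val; exact: dG.
have IK : \int[@lebesgue_measure R]_(s in `[0, +oo[) (K * expR (- s)) = K.
  rewrite RintegralZl//; last exact: integrable_expRN.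
  by rewrite /Rintegral integral_expRN /= mulr1.
move: IG; rewrite /g RintegralD// ?IK; last exact: integrable_exp_dominated cf fK.
by rewrite /G oppr0 expR0; lra.
Qed.

(** * The weight and its moments *)

(** The weight [exp (- s^3 / 3)] of the moments below. *)
Definition weight (R : realType) (s : R) : R := expR (- (s ^+ 3) / 3).

Lemma weight_gt0 (R : realType) (s : R) : 0 < weight s.
Proof. exact: expR_gt0. Qed.

Lemma is_derive_weight (R : realType) (s : R) :
  is_derive s 1 (@weight R) (- s ^+ 2 * weight s).
Proof.
rewrite /weight; apply: is_derive_eq; rewrite /= /GRing.scale /=.
by rewrite /weight; field.
Qed.

Lemma continuous_weight (R : realType) : continuous (@weight R).
Proof. exact: (is_derive_continuous (@is_derive_weight R)). Qed.

Lemma expX_weight_le (R : realType) (n : nat) (s : R) : 0 <= s ->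
  s ^+ n * weight s <= n`!%:R * expR 6 * expR (- s).
Proof.
move=> s0.
have sn : s ^+ n <= n`!%:R * expR s.
  case: n => [|n]; first by rewrite expr0 fact0 mul1r -expR0 ler_expR.
  have := expR_ge1Dxn n s0; rewrite -ler_pdivrMl ?ltr0n ?fact_gt0// => h.
  by rewrite mulrC; lra.
(* s^3/3 >= 4 s - 16/3, the tangent line at s = 2 *)
have ws : weight s <= expR (6 - 2 * s).
  rewrite ler_expR.
  have : 0 <= (s - 2) ^+ 2 * (s + 4) by rewrite mulr_ge0 ?sqr_ge0//; lra.
  have -> : (s - 2) ^+ 2 * (s + 4) = s ^+ 3 - 12 * s + 16 by ring.
  by lra.
have -> : n`!%:R * expR 6 * expR (- s) = n`!%:R * expR s * expR (6 - 2 * s).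
  by rewrite -!mulrA -!expRD; congr (_ * expR _); ring.
by rewrite ler_pM ?exprn_ge0// ltW ?weight_gt0.
Qed.

Lemma cvg_weight (R : realType) : @weight R s @[s --> +oo] --> 0.
Proof.
apply: (@squeeze_cvgr _ _ _ _ (fun=> 0) (fun s : R => expR 6 * expR (- s))).
- near=> s; rewrite ltW ?weight_gt0//=.
  have s0 : 0 <= s by near: s; exact: nbhs_pinfty_ge.
  by have := expX_weight_le 0 s0; rewrite expr0 fact0 !mul1r.
- exact: cvg_cst.
- by rewrite -(mulr0 (expR 6)); apply: cvgM; [exact: cvg_cst|exact: cvgr_expR].
Unshelve. all: by end_near. Qed.

Lemma moment_dominated (R : realType) (n : nat) (phi : R -> R) (K s : R) :
  `|phi s| <= K -> 0 <= s ->
  `|s ^+ n * phi s * weight s| <= (K * (n`!%:R * expR 6)) * expR (- s).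
Proof.
move=> phiK s0; rewrite mulrAC normrM mulrC -mulrA ler_pM//.
by rewrite ger0_norm ?expX_weight_le// mulr_ge0 ?exprn_ge0// ltW ?weight_gt0.
Qed.

Lemma continuous_moment (R : realType) (n : nat) (phi : R -> R) :
  continuous phi -> continuous (fun s : R => s ^+ n * phi s * weight s).
Proof.
move=> cphi s; apply: cvgM; last exact: continuous_weight.
by apply: cvgM; [exact: exprn_continuous|exact: cphi].
Qed.

Lemma integrable_moment (R : realType) (n : nat) (phi : R -> R) (K : R) :
  continuous phi -> (forall s, `|phi s| <= K) ->
  (@lebesgue_measure R).-integrable `[0, +oo[
    (EFin \o (fun s => s ^+ n * phi s * weight s)).
Proof.
move=> cphi phiK; apply: (@integrable_exp_dominated R _ (K * (n`!%:R * expR 6))).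
  exact: continuous_moment.
by move=> s; apply: moment_dominated.
Qed.

(** * Airy-type integrals *)

(** The [n]-th moment of [weight] against [cos (a - b s)]; the real part of an
    Airy-type function of [b], with phase [a]. *)
Definition airy (R : realType) (n : nat) (a b : R) : R :=
  \int[@lebesgue_measure R]_(s in `[0, +oo[)
    (s ^+ n * cos (a - b * s) * weight s).

(** The [n]-th moment of [weight]; [moment R 0] is [C0 R]. *)
Definition moment (R : realType) (n : nat) : R :=
  \int[@lebesgue_measure R]_(s in `[0, +oo[) (s ^+ n * weight s).

Lemma continuous_cos_phase (R : realType) (a b : R) :
  continuous (fun s : R => cos (a - b * s)).
Proof.
by move=> s; apply/differentiable_continuous/derivable1_diffP/ex_derive.
Qed.

Lemma integrable_airy (R : realType) (n : nat) (a b : R) :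
  (@lebesgue_measure R).-integrable `[0, +oo[
    (EFin \o (fun s => s ^+ n * cos (a - b * s) * weight s)).
Proof.
apply: (@integrable_moment R n _ 1); first exact: continuous_cos_phase.
by move=> s; exact: cos_max.
Qed.

Lemma integrable_expX_weight (R : realType) (n : nat) :
  (@lebesgue_measure R).-integrable `[0, +oo[
    (EFin \o (fun s => s ^+ n * weight s)).
Proof.
have c1 : continuous (fun _ : R => 1 : R) by move=> s; apply: cvg_cst.
have := @integrable_moment R n (fun=> 1) 1 c1.
rewrite normr1 => /(_ (fun=> lexx _)).
by apply: eq_integrable => // s _ /=; rewrite mulr1.
Qed.

Lemma moment_ge0 (R : realType) (n : nat) : 0 <= @moment R n.
Proof.
apply: Rintegral_ge0 => s /=; rewrite in_itv /= andbT => s0.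
by rewrite mulr_ge0 ?exprn_ge0// ltW ?weight_gt0.
Qed.

(** An integrable function dominated pointwise by a combination of two moment
    densities has its integral dominated by the same combination of moments. *)
Lemma Rintegral_moment_le (R : realType) (f : R -> R) (m n : nat) (k l : R) :
  (@lebesgue_measure R).-integrable `[0, +oo[ (EFin \o f) ->
  (forall s, 0 <= s ->
     `|f s| <= k * (s ^+ m * weight s) + l * (s ^+ n * weight s)) ->
  `|\int[@lebesgue_measure R]_(s in `[0, +oo[) f s|
     <= k * moment R m + l * moment R n.
Proof.
move=> fi fle.
have iX j c : (@lebesgue_measure R).-integrable `[0, +oo[
    (EFin \o (fun s => c * (s ^+ j * weight s))).
  by apply: integrable_scale => //; exact: integrable_expX_weight.
rewrite (le_trans (le_normr_Rintegral _ fi))//.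
rewrite -!RintegralZl ?integrable_expX_weight// -RintegralD//.
apply: le_Rintegral => //.
- by have := integrable_norm fi; apply: eq_integrable.
- by apply: integrable_add => //; exact: iX.
- by move=> s /=; rewrite in_itv /= andbT; exact: fle.
Qed.

Lemma airy_le (R : realType) (n : nat) (a b : R) : `|airy n a b| <= moment R n.
Proof.
rewrite -[leRHS]addr0 -[X in _ + X](mul0r (moment R 0)) -[X in X + _]mul1r.
apply: Rintegral_moment_le; first exact: integrable_airy.
move=> s s0; rewrite mul0r addr0 mul1r.
rewrite mulrAC normrM ger0_norm; last first.
  by rewrite mulr_ge0 ?exprn_ge0// ltW ?weight_gt0.
by rewrite ler_piMr ?cos_max// mulr_ge0 ?exprn_ge0// ltW ?weight_gt0.
Qed.

Lemma airy_lipschitz (R : realType) (n : nat) (a b a' b' : R) :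
  `|airy n a b - airy n a' b'|
    <= `|a - a'| * moment R n + `|b - b'| * moment R n.+1.
Proof.
rewrite /airy -RintegralB ?integrable_airy//.
apply: Rintegral_moment_le.
  by apply: integrable_sub => //; exact: integrable_airy.
move=> s s0.
have -> : s ^+ n * cos (a - b * s) * weight s - s ^+ n * cos (a' - b' * s) * weight s
  = (s ^+ n * weight s) * (cos (a - b * s) - cos (a' - b' * s)) by ring.
have w0 : 0 <= s ^+ n * weight s by rewrite mulr_ge0 ?exprn_ge0// ltW ?weight_gt0.
rewrite normrM ger0_norm//.
have -> : `|a - a'| * (s ^+ n * weight s) + `|b - b'| * (s ^+ n.+1 * weight s) =
  (s ^+ n * weight s) * (`|a - a'| + `|b - b'| * s) by rewrite exprS; ring.
rewrite ler_wpM2l// (le_trans (cos_lipschitz _ _))//.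
have -> : a - b * s - (a' - b' * s) = (a - a') - (b - b') * s by ring.
by rewrite (le_trans (ler_normB _ _))// normrM (ger0_norm s0).
Qed.

(** The second-order remainder bound behind the differentiation of [airy] in
    the direction [(p, q)]. *)
Lemma airy_taylor1 (R : realType) (n : nat) (a b p q h : R) :
  `|airy n (a + h * p) (b + h * q) - airy n a b
    - h * (p * airy n (a + pi / 2) b - q * airy n.+1 (a + pi / 2) b)|
  <= h ^+ 2 * (2 * p ^+ 2 * moment R n + 2 * q ^+ 2 * moment R n.+2).
Proof.
have iA := integrable_airy; have mI := measurable_itv `[(0:R), +oo[.
have iZ j a' b' c : (@lebesgue_measure R).-integrable `[0, +oo[
    (EFin \o (fun s => c * (s ^+ j * cos (a' - b' * s) * weight s))).
  by apply: integrable_scale => //; exact: iA.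
have iB : (@lebesgue_measure R).-integrable `[0, +oo[
    (EFin \o (fun s => p * (s ^+ n * cos (a + pi / 2 - b * s) * weight s)
      - q * (s ^+ n.+1 * cos (a + pi / 2 - b * s) * weight s))).
  by apply: integrable_sub.
have iD : (@lebesgue_measure R).-integrable `[0, +oo[
    (EFin \o (fun s => s ^+ n * cos (a + h * p - (b + h * q) * s) * weight s
      - s ^+ n * cos (a - b * s) * weight s)).
  by apply: integrable_sub.
have ihB : (@lebesgue_measure R).-integrable `[0, +oo[
    (EFin \o (fun s => h * (p * (s ^+ n * cos (a + pi / 2 - b * s) * weight s)
      - q * (s ^+ n.+1 * cos (a + pi / 2 - b * s) * weight s)))).
  by apply: integrable_scale.
have -> : h ^+ 2 * (2 * p ^+ 2 * moment R n + 2 * q ^+ 2 * moment R n.+2) =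
  h ^+ 2 * (2 * p ^+ 2) * moment R n + h ^+ 2 * (2 * q ^+ 2) * moment R n.+2.
  by ring.
have -> : airy n (a + h * p) (b + h * q) - airy n a b =
  \int[@lebesgue_measure R]_(s in `[0, +oo[)
    (s ^+ n * cos (a + h * p - (b + h * q) * s) * weight s
      - s ^+ n * cos (a - b * s) * weight s).
  by rewrite RintegralB.
have -> : p * airy n (a + pi / 2) b - q * airy n.+1 (a + pi / 2) b =
  \int[@lebesgue_measure R]_(s in `[0, +oo[)
    (p * (s ^+ n * cos (a + pi / 2 - b * s) * weight s)
      - q * (s ^+ n.+1 * cos (a + pi / 2 - b * s) * weight s)).
  by rewrite RintegralB// !RintegralZl.
rewrite -RintegralZl// -RintegralB//.
apply: Rintegral_moment_le; first by apply: integrable_sub.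
move=> s s0.
set u := a - b * s; set k := p - q * s.
have w0 : 0 <= s ^+ n * weight s by rewrite mulr_ge0 ?exprn_ge0// ltW ?weight_gt0.
have -> : a + h * p - (b + h * q) * s = u + h * k by rewrite /u /k; ring.
have -> : a + pi / 2 - b * s = u + pi / 2 by rewrite /u; ring.
rewrite cosDpihalf exprS.
have -> : s ^+ n * cos (u + h * k) * weight s - s ^+ n * cos u * weight s -
  h * (p * (s ^+ n * - sin u * weight s) - q * (s * s ^+ n * - sin u * weight s))
  = (s ^+ n * weight s) * (cos (u + h * k) - cos u + h * k * sin u).
  by rewrite /k; ring.
rewrite normrM ger0_norm// !exprS.
apply: le_trans (_ : s ^+ n * weight s * (h * k) ^+ 2 <= _).
  by rewrite ler_wpM2l// cos_taylor1.
apply: le_trans (_ : s ^+ n * weight s *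
   (h ^+ 2 * (2 * p ^+ 2 + 2 * q ^+ 2 * s ^+ 2)) <= _); last first.
  by rewrite le_eqVlt; apply/orP; left; apply/eqP; ring.
rewrite ler_wpM2l// exprMn ler_wpM2l ?sqr_ge0// /k.
have : 0 <= (p + q * s) ^+ 2 by exact: sqr_ge0.
rewrite -subr_ge0 => h0; apply: le_trans h0 _.
by rewrite le_eqVlt; apply/orP; left; apply/eqP; ring.
Qed.

(** Integrating the derivative of [cos (a - b s) * weight s] over the half-line
    gives the equation satisfied by [airy]. *)
Lemma airy_ode (R : realType) (a b : R) :
  b * airy 0 (a + pi / 2) b = airy 2 (a + pi) b + cos a.
Proof.
pose F s := cos (a - b * s) * weight s.
pose f s := b * sin (a - b * s) * weight s - s ^+ 2 * cos (a - b * s) * weight s.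
have dF (s : R) : is_derive s 1 F (f s).
  have dw := is_derive_weight s.
  by rewrite /F /f; apply: is_derive_eq; rewrite /= /GRing.scale /=; ring.
have csin : continuous (fun s : R => sin (a - b * s)).
  by move=> s; apply/differentiable_continuous/derivable1_diffP/ex_derive.
have i1 : (@lebesgue_measure R).-integrable `[0, +oo[
    (EFin \o (fun s => b * (s ^+ 0 * sin (a - b * s) * weight s))).
  apply: integrable_scale => //; apply: (@integrable_moment R 0 _ 1) => // s.
  exact: sin_max.
have i2 := integrable_airy 2 a b.
have FT : \int[@lebesgue_measure R]_(s in `[0, +oo[) f s = - F 0.
  apply: (@Rintegral_exp_dominated_FTC2y R f F
    (`|b| * (1 * (0`!%:R * expR 6)) + 1 * (2`!%:R * expR 6))) => //.
  - move=> s; apply: cvgB.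
      apply: cvgM; last exact: continuous_weight.
      by apply: cvgM; [exact: cvg_cst|exact: csin].
    exact: (@continuous_moment R 2 _ (@continuous_cos_phase R a b) s).
  - move=> s s0; rewrite (le_trans (ler_normB _ _))// mulrDl lerD//.
      rewrite -mulrA normrM -[leRHS]mulrA ler_wpM2l//.
      have := @moment_dominated R 0 (fun s => sin (a - b * s)) 1 s (sin_max _) s0.
      by rewrite expr0 mul1r.
    exact: (@moment_dominated R 2 (fun s => cos (a - b * s)) 1 s (cos_max _) s0).
  - apply/norm_cvg0P; apply: (@squeeze_cvgr _ _ _ _ (fun=> 0) (@weight R)).
    + near=> s; rewrite normr_ge0 /= normrM (ger0_norm (ltW (weight_gt0 s))).
      by rewrite ler_piMl ?cos_max// ltW ?weight_gt0.
    + exact: cvg_cst.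
    + exact: cvg_weight.
have F0 : F 0 = cos a by rewrite /F mulr0 subr0 /weight expr0n /= oppr0 mul0r expR0 mulr1.
have E : \int[@lebesgue_measure R]_(s in `[0, +oo[) f s =
   - (b * airy 0 (a + pi / 2) b) + airy 2 (a + pi) b.
  rewrite /airy -RintegralZl ?integrable_airy//.
  rewrite addrC -RintegralB//; last 2 first.
  - exact: integrable_airy.
  - by apply: integrable_scale => //; exact: integrable_airy.
  apply: eq_Rintegral => s _; rewrite /f.
  have -> : a + pi / 2 - b * s = a - b * s + pi / 2 by ring.
  have -> : a + pi - b * s = a - b * s + pi by ring.
  by rewrite cosDpihalf cosDpi; ring.
by move: FT; rewrite E F0; lra.
Unshelve. all: by end_near. Qed.

(** The second velocity derivative of the profile takes different values at the
    rescaled velocities [0] and [1]. *)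
Lemma airy2_gap (R : realType) : 0 < airy 2 pi 1 - airy 2 pi 0 :> R.
Proof.
have pi2 := pi_ge2 R.
pose f (s : R) :=
  s ^+ 2 * cos (pi - 1 * s) * weight s - s ^+ 2 * cos (pi - 0 * s) * weight s.
have fE s : f s = s ^+ 2 * weight s * (1 - cos s).
  rewrite /f mul1r mul0r subr0 cospi (addrC pi) cosDpi cosN; ring.
have f0 s : 0 <= f s.
  by rewrite fE mulr_ge0 ?subr_ge0 ?cos_le1// mulr_ge0 ?sqr_ge0// ltW ?weight_gt0.
have cos_decr (x y : R) : 0 <= x -> x < y -> y <= 2 -> cos y < cos x.
  by move=> x0 xy y2; rewrite ltr_cos// in_itv /=; apply/andP; split; lra.
pose c := (1 - cos 1) * expR (- 8 / 3) : R.
have c0 : 0 < c.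
  rewrite mulr_gt0 ?expR_gt0// subr_gt0 -[ltRHS]cos0 cos_decr//; lra.
(* on [1, 2] the cosine is at most cos 1, and s^3 at most 8 *)
have fc s : 1 <= s <= 2 -> c <= f s.
  move=> /andP[s1 s2]; rewrite fE mulrC /c ler_pM//.
  - rewrite lerB//; move: s1; rewrite le_eqVlt => /predU1P[<-//|s1].
    by rewrite ltW// cos_decr.
  - have h1 : 1 <= s ^+ 2 by exact: exprn_ege1.
    have h2 : expR (- 8 / 3) <= weight s.
      rewrite ler_expR !mulNr lerN2 ler_pM2r ?invr_gt0//.
      have -> : (8 : R) = 2 ^+ 3 by rewrite -natrX.
      by rewrite lerXn2r// nnegrE; lra.
    by rewrite -[leLHS]mul1r ler_pM// expR_ge0.
have iA := integrable_airy.
have fi : (@lebesgue_measure R).-integrable `[0, +oo[ (EFin \o f).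
  by apply: integrable_sub => //; exact: iA.
rewrite /airy -RintegralB ?integrable_airy// -/(f _).
apply: (lt_le_trans c0).
have mf D : measurable_fun D f.
  apply: measurable_funTS; apply: continuous_measurable_fun => s.
  by apply: cvgB; exact: (@continuous_moment R 2 _ (@continuous_cos_phase R _ _) s).
rewrite -lee_fin /Rintegral fineK ?integrable_fin_num//.
apply: (@le_trans _ _ (\int[@lebesgue_measure R]_(s in `[1%R, 2%R]) (f s)%:E)%E).
  apply: (@le_trans _ _ (\int[@lebesgue_measure R]_(s in `[1%R, 2%R]) c%:E)%E).
    rewrite integral_cst//= lebesgue_measure_itv /= lte_fin ltr1n -EFinB -EFinM.
    by rewrite lee_fin (_ : 2 - 1 = 1 :> R) ?mulr1//; ring.
  apply: ge0_le_integral => //.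
  - by move=> s _; rewrite lee_fin ltW.
  - by apply/measurable_EFinP; exact: mf.
apply: ge0_subset_integral => //.
- by apply/measurable_EFinP; exact: mf.
- by move=> s _; rewrite lee_fin f0.
- by move=> s /=; rewrite !in_itv /= andbT => /andP[s1 _]; lra.
Qed.

(** * The constant C0 as a value of the Gamma function *)

Lemma continuous_Gamma_density (R : realType) (c t : R) : 0 < t ->
  {for t, continuous (fun t : R => t `^ c * expR (- t))}.
Proof.
move=> t0; apply: cvgM; last exact: continuous_expRN.
have dt := is_derive1_powR c t0.
have ct : {for t, continuous (@powR R ^~ c)}.
  by apply/differentiable_continuous/derivable1_diffP/ex_derive.
exact: ct.
Qed.

(** An integral over the open half-line is the limit of the integrals over an
    increasing sequence of compact intervals exhausting it. *)
Lemma cvg_integral_exhaust (R : realType) (f : R -> R) (u v : nat -> R) :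
  (forall n, 0 < u n) ->
  (forall m n, (m <= n)%N -> u n <= u m /\ v m <= v n) ->
  (forall t, 0 < t -> exists n, u n <= t <= v n) ->
  (forall t, 0 < t -> 0 <= f t) -> (forall t : R, 0 < t -> {for t, continuous f}) ->
  (\int[@lebesgue_measure R]_(t in `[u n, v n]) (f t)%:E @[n --> \oo] -->
   \int[@lebesgue_measure R]_(t in `]0%R, +oo[) (f t)%:E)%E.
Proof.
move=> u0 uv ex f0 cf.
have -> : `]0, +oo[%classic = \bigcup_n `[u n, v n]%classic :> set R.
  apply/seteqP; split => [t|t [n _]] /=; rewrite !in_itv /= andbT.
    by move=> /ex[n un]; exists n => //=; rewrite in_itv.
  by move=> /andP[+ _]; exact: lt_le_trans.
have cvgI := @ge0_nondecreasing_set_cvg_integral _ _ _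
  (fun n => `[u n, v n]%classic : set (measurableTypeR R)) (EFin \o f)
  (@lebesgue_measure R).
apply: cvgI => //.
- move=> m n mn; rewrite subsetEset => t /=; rewrite !in_itv /= => /andP[ut tv].
  have [h1 h2] := uv _ _ mn.
  by rewrite (le_trans h1)//= (le_trans tv).
- move=> n; apply/measurable_EFinP; apply: subspace_continuous_measurable_fun => //.
  apply: continuous_in_subspaceT => t; rewrite inE /= in_itv /= => /andP[ut _].
  by apply: cf; exact: lt_le_trans ut.
- move=> n t /=; rewrite in_itv /= => /andP[ut _].
  by rewrite lee_fin f0//; exact: lt_le_trans ut.
Qed.

(** The substitution [t = s^3 / 3]; the factor [s^-2] of the density cancels the
    Jacobian [s^2]. *)
Lemma Gamma13_subst (R : realType) (a b : R) : 0 < a -> a <= b ->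
  (\int[@lebesgue_measure R]_(t in `[(a ^+ 3 / 3)%R, (b ^+ 3 / 3)%R])
     (t `^ (1 / 3 - 1) * expR (- t))%:E =
   \int[@lebesgue_measure R]_(s in `[a, b])
     (3 `^ (2 / 3) * weight s)%:E)%E.
Proof.
move=> a0 ab.
pose F (s : R) := s ^+ 3 / 3.
pose G (t : R) := t `^ (1 / 3 - 1) * expR (- t).
have dF (s : R) : is_derive s 1 F (s ^+ 2).
  by rewrite /F; apply: is_derive_eq; rewrite /= /GRing.scale /=; field.
have F'E : derive1 F = fun s => s ^+ 2.
  by apply/funext => s; rewrite derive1E; apply: derive_val; exact: dF.
have cF : continuous F := is_derive_continuous dF.
have csq : continuous (fun s : R => s ^+ 2) by exact: exprn_continuous.
rewrite (@integration_by_substitution_increasing R F G a b ab).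
- apply: eq_integral => s; rewrite inE /= in_itv /= => /andP[as_ _].
  have s0 : 0 < s by exact: lt_le_trans as_.
  congr EFin; rewrite /= F'E /G /F /weight mulNr !fctE /=.
  rewrite mulrAC; congr (_ * _).
  have -> : 1 / 3 - 1 = - (2 / 3) :> R by field.
  have -> : (s ^+ 3 / 3) `^ (- (2 / 3)) = (s ^+ 3) `^ (- (2 / 3)) * 3 `^ (2 / 3).
    rewrite powRM ?exprn_ge0 ?(ltW s0)//; congr (_ * _).
    by rewrite -[X in X `^ _ = _]powR_inv1// -powRrM; congr (_ `^ _); ring.
  rewrite -[s ^+ 3]powR_mulrn ?(ltW s0)// -powRrM.
  have -> : 3%:R * - (2 / 3) = - 2%:R :> R by field.
  by rewrite powR_invn ?(ltW s0)// mulrAC mulVf ?mul1r// expf_neq0 ?gt_eqF.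
- move=> x y; rewrite !in_itv /= => /andP[ax _] /andP[ay _] xy.
  by rewrite ltr_pM2r ?invr_gt0// ltrXn2r// (le_trans (ltW a0)).
- by move=> s _; rewrite F'E; exact: csq.
- by apply/cvg_ex; exists (a ^+ 2); rewrite F'E; apply: cvg_at_right_filter; exact: csq.
- by apply/cvg_ex; exists (b ^+ 2); rewrite F'E; apply: cvg_at_left_filter; exact: csq.
- split.
  + by move=> s _; apply: ex_derive; exact: dF.
  + by apply: cvg_at_right_filter; exact: cF.
  + by apply: cvg_at_left_filter; exact: cF.
- apply: continuous_in_subspaceT => t; rewrite inE /= in_itv /= => /andP[ut _].
  by apply: continuous_Gamma_density; apply: lt_le_trans ut; rewrite divr_gt0 ?exprn_gt0.
Qed.

Lemma C0_Gamma (R : realType) : C0 R = 3 `^ (- (2 / 3)) * Gamma (1 / 3).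
Proof.
(* the half-line is exhausted by [1/(n+1), n+1], and by its image under s^3/3 *)
pose u n : R := n.+1%:R^-1; pose v n : R := n.+1%:R.
have u0 n : 0 < u n by rewrite invr_gt0.
have uv m n : (m <= n)%N -> u n <= u m /\ v m <= v n.
  by move=> mn; rewrite /u /v lef_pV2 ?posrE// !ler_nat ltnS.
have exuv t : 0 < t -> exists n, u n <= t / 3 /\ 3 * t <= v n.
  move=> t0; pose M := Num.max (t / 3)^-1 (3 * t).
  exists (Num.truncn M); rewrite /u /v; split.
    rewrite -[leRHS]invrK lef_pV2 ?posrE ?invr_gt0 ?divr_gt0//.
    by apply: ltW; apply: le_lt_trans (truncnS_gt M); rewrite le_max lexx.
  by apply: ltW; apply: le_lt_trans (truncnS_gt M); rewrite le_max lexx orbT.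
pose w (s : R) := 3 `^ (2 / 3) * weight s.
have k0 : 0 < (3 : R) `^ (2 / 3) by rewrite powR_gt0.
have Hw : (\int[@lebesgue_measure R]_(s in `[u n, v n]) (w s)%:E @[n --> \oo] -->
   \int[@lebesgue_measure R]_(s in `]0%R, +oo[) (w s)%:E)%E.
  apply: cvg_integral_exhaust => //.
  - move=> t t0; have [n [h1 h2]] := exuv t t0; exists n; apply/andP; split; lra.
  - by move=> t _; rewrite mulr_ge0 ?ltW ?weight_gt0.
  - by move=> t _; apply: cvgM; [exact: cvg_cst|exact: continuous_weight].
pose G (t : R) := t `^ (1 / 3 - 1) * expR (- t).
have HG : (\int[@lebesgue_measure R]_(t in `[(u n ^+ 3 / 3)%R, (v n ^+ 3 / 3)%R])
     (G t)%:E @[n --> \oo] -->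
   \int[@lebesgue_measure R]_(t in `]0%R, +oo[) (G t)%:E)%E.
  apply: cvg_integral_exhaust.
  - by move=> n; rewrite divr_gt0 ?exprn_gt0.
  - move=> m n mn; have [h1 h2] := uv m n mn; split.
      by rewrite ler_pM2r ?invr_gt0// lerXn2r// ?nnegrE ?(ltW (u0 _)).
    by rewrite ler_pM2r ?invr_gt0// lerXn2r// nnegrE ler0n.
  - move=> t t0; have [n [h1 h2]] := exuv t t0; exists n; apply/andP; split.
      have : u n ^+ 3 <= u n.
        by rewrite ler_iXnr ?(ltW (u0 n))// /u invf_le1// ler1n.
      by have := u0 n; lra.
    have : v n <= v n ^+ 3 by rewrite ler_eXnr// /v ler1n.
    by lra.
  - by move=> t _; rewrite mulr_ge0 ?powR_ge0 ?expR_ge0.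
  - exact: continuous_Gamma_density.
have E : (\int[@lebesgue_measure R]_(t in `]0%R, +oo[) (G t)%:E =
          \int[@lebesgue_measure R]_(s in `]0%R, +oo[) (w s)%:E)%E.
  apply: cvg_unique HG _ => //.
  rewrite (_ : (fun n => _) = (fun n =>
    \int[@lebesgue_measure R]_(s in `[u n, v n]) (w s)%:E)%E) //.
  apply/funext => n; apply: Gamma13_subst => //.
  by rewrite (@le_trans _ _ 1)// /u /v ?invf_le1 ?ler1n.
have iw := integrable_expX_weight R 0.
have iw' : (@lebesgue_measure R).-integrable `[0, +oo[ (EFin \o @weight R).
  by move: iw; apply: eq_integrable => // s _ /=; rewrite expr0 mul1r.
have iw'' : (@lebesgue_measure R).-integrable `]0, +oo[ (EFin \o @weight R).
  by apply: integrableS iw' => //; apply: subset_itvr; rewrite bnd_simp.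
have -> : Gamma (1 / 3) = 3 `^ (2 / 3) * C0 R.
  rewrite /Gamma /Rintegral -/(G _) E -/(Rintegral _ _ _) /w RintegralZl//.
  by rewrite Rintegral_itv_obnd_cbnd.
by rewrite mulrA -powRD ?addNr ?powRr0 ?mul1r// pnatr_eq0 implybT.
Qed.

(** * Smooth functions on phase space *)

(** A quadratic remainder identifies the limit of the difference quotients. *)
Lemma quadratic_remainder_cvg (R : realType) (f : R -> R) (D K : R) :
  (forall h, `|f h - f 0 - h * D| <= h ^+ 2 * K) ->
  h^-1 *: (f h - f 0) @[h --> 0^'] --> D.
Proof.
move=> fK; apply/cvgrPdistC_le => e e0.
have K0 : 0 <= K.
  by have := fK 1; rewrite expr1n !mul1r; apply: le_trans.
have K1 : 0 < K + 1 by lra.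
near=> h.
have h0 : h != 0 by near: h; exact: nbhs_dnbhs_neq.
have he : `|h| <= e / (K + 1).
  near: h; apply: dnbhs0_le; exact: divr_gt0.
have -> : h^-1 *: (f h - f 0) - D = h^-1 * (f h - f 0 - h * D).
  by rewrite [RHS]mulrBr mulKf.
rewrite normrM normfV ler_pdivrMl ?normr_gt0//.
rewrite (le_trans (fK h))// -real_normK ?num_real// expr2 -mulrA ler_wpM2l//.
rewrite (le_trans (_ : _ <= `|h| * (K + 1)))//; first by rewrite ler_wpM2l//; lra.
by rewrite -ler_pdivlMr.
Unshelve. all: by end_near. Qed.

Lemma Ck_on_add (R : realType) (V : normedModType R) (k : nat) (f g : V -> R) :
  Ck_on setT k f -> Ck_on setT k g -> Ck_on setT k (fun z => f z + g z).
Proof.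
elim: k f g => [|k IH] f g [cf df] [cg dg].
  by split=> // z _; apply: cvgD; [exact: cf|exact: cg].
split=> [z _|e]; first by apply: cvgD; [exact: cf|exact: cg].
have [df1 df2] := df e; have [dg1 dg2] := dg e; split.
  by move=> z _; apply: derivableD; [exact: df1|exact: dg1].
rewrite (_ : 'D_e _ = (fun z => 'D_e f z + 'D_e g z)); first exact: IH.
by apply/funext => z; apply: deriveD; [exact: df1|exact: dg1].
Qed.

Lemma Ck_on_scale (R : realType) (V : normedModType R) (k : nat) (c : R)
    (f : V -> R) : Ck_on setT k f -> Ck_on setT k (fun z => c * f z).
Proof.
elim: k f => [|k IH] f [cf df].
  by split=> // z _; apply: cvgM; [exact: cvg_cst|exact: cf].
split=> [z _|e]; first by apply: cvgM; [exact: cvg_cst|exact: cf].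
have [df1 df2] := df e; split.
  by move=> z _; apply: derivableZ; exact: df1.
rewrite (_ : 'D_e _ = (fun z => c * 'D_e f z)); first exact: IH.
by apply/funext => z; apply: deriveZ; exact: df1.
Qed.

Section wave.
Context (R : realType) (d : nat) (i0 : 'I_d) (p q : R).

(** The function [airy n (p x_i + theta) (q v_i)] of the phase variables, where
    [i] is the index [i0].  The shift [theta] makes the family of these functions
    stable, up to linear combinations, under differentiation in any direction. *)
Definition wave (n : nat) (theta : R) (z : phase R d) : R :=
  airy n (p * pos z 0 i0 + theta) (q * vel z 0 i0).

Lemma wave_diff_le (n : nat) (theta : R) (z w : phase R d) :
  `|wave n theta z - wave n theta w|
    <= `|p| * `|pos z 0 i0 - pos w 0 i0| * moment R n
       + `|q| * `|vel z 0 i0 - vel w 0 i0| * moment R n.+1.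
Proof.
have := airy_lipschitz n (p * pos z 0 i0 + theta) (q * vel z 0 i0)
   (p * pos w 0 i0 + theta) (q * vel w 0 i0).
by rewrite opprD addrACA subrr addr0 -!mulrBr !normrM.
Qed.

Lemma continuous_wave (n : nat) (theta : R) : continuous (wave n theta).
Proof.
move=> z.
have cx : pos w 0 i0 @[w --> z] --> pos z 0 i0.
  apply: (@cvg_comp _ _ _ (@pos R d) (fun M : 'rV[R]_d => M 0 i0)).
    apply: (@cvg_comp _ _ _ fst snd); [exact: cvg_fst|exact: cvg_snd].
  exact: coord_continuous.
have cv : vel w 0 i0 @[w --> z] --> vel z 0 i0.
  apply: (@cvg_comp _ _ _ (@vel R d) (fun M : 'rV[R]_d => M 0 i0)).
    exact: cvg_snd.
  exact: coord_continuous.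
apply/cvgrPdist_le => e e0.
pose K := `|p| * moment R n + `|q| * moment R n.+1 + 1.
have Kp : 0 <= `|p| * moment R n by rewrite mulr_ge0 ?moment_ge0.
have Kq : 0 <= `|q| * moment R n.+1 by rewrite mulr_ge0 ?moment_ge0.
have K0 : 0 < K by rewrite /K; lra.
near=> w.
have hx : `|pos z 0 i0 - pos w 0 i0| <= e / K.
  by near: w; move/cvgrPdist_le : cx; apply; exact: divr_gt0.
have hv : `|vel z 0 i0 - vel w 0 i0| <= e / K.
  by near: w; move/cvgrPdist_le : cv; apply; exact: divr_gt0.
rewrite (le_trans (wave_diff_le n theta z w))//.
rewrite (le_trans (_ : _ <= `|p| * moment R n * (e / K)
                         + `|q| * moment R n.+1 * (e / K)))//.
  by rewrite lerD// mulrAC ler_wpM2l.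
rewrite -mulrDl mulrA ler_pdivrMr// mulrC ler_wpM2l ?(ltW e0)// /K; lra.
Unshelve. all: by end_near. Qed.

Lemma wave_derive_cvg (n : nat) (theta : R) (z e : phase R d) :
  h^-1 *: (wave n theta (h *: e + z) - wave n theta z) @[h --> 0^'] -->
  p * pos e 0 i0 * wave n (theta + pi / 2) z
    - q * vel e 0 i0 * wave n.+1 (theta + pi / 2) z.
Proof.
pose a := p * pos z 0 i0 + theta; pose b := q * vel z 0 i0.
pose f h := airy n (a + h * (p * pos e 0 i0)) (b + h * (q * vel e 0 i0)).
have f0 : f 0 = wave n theta z by rewrite /f !mul0r !addr0.
have fE h : wave n theta (h *: e + z) = f h.
  by rewrite /wave /f /a /b /pos /vel /= !mxE; congr airy; ring.
have aE m : wave m (theta + pi / 2) z = airy m (a + pi / 2) b.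
  by rewrite /wave addrA.
under eq_fun do rewrite fE -f0.
rewrite !aE; apply: quadratic_remainder_cvg => h.
rewrite f0; exact: airy_taylor1.
Qed.

Lemma derivable_wave (n : nat) (theta : R) (z e : phase R d) :
  derivable (wave n theta) z e.
Proof. by apply/cvg_ex; eexists; exact: wave_derive_cvg. Qed.

Lemma derive_wave (n : nat) (theta : R) (e : phase R d) :
  'D_e (wave n theta) = fun z =>
    (p * pos e 0 i0) * wave n (theta + pi / 2) z
    + (- (q * vel e 0 i0)) * wave n.+1 (theta + pi / 2) z.
Proof.
apply/funext => z; rewrite mulNr.
by apply: cvg_lim => //; exact: wave_derive_cvg.
Qed.

Lemma Ck_on_wave (k n : nat) (theta : R) : Ck_on setT k (wave n theta).
Proof.
elim: k n theta => [|k IH] n theta.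
  by split=> // z _; exact: continuous_wave.
split=> [z _|e]; first exact: continuous_wave.
split=> [z _|]; first exact: derivable_wave.
by rewrite derive_wave; apply: Ck_on_add; apply: Ck_on_scale; exact: IH.
Qed.

End wave.

(** * Euclidean norms, Hoelder seminorms and essential suprema *)

Section enorm.
Context (R : realType).

Lemma sum_sqr_ge0 (m n : nat) (A : 'M[R]_(m, n)) :
  0 <= \sum_i \sum_j `|A i j| ^+ 2.
Proof. by apply: sumr_ge0 => i _; apply: sumr_ge0 => j _; exact: sqr_ge0. Qed.

Lemma enorm_single (m n : nat) (A : 'M[R]_(m, n)) i0 j0 :
  (forall i j, (i, j) != (i0, j0) -> A i j = 0) -> enorm A = `|A i0 j0|.
Proof.
move=> A0; rewrite /enorm (bigD1 i0)//= (bigD1 j0)//= !big1 ?addr0.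
- by rewrite sqrtr_sqr normr_id.
- move=> i ii0; apply: big1 => j _; rewrite A0 ?normr0 ?expr0n//.
  by apply: contraNneq ii0 => -[->].
- move=> j jj0; rewrite A0 ?normr0 ?expr0n//.
  by apply: contraNneq jj0 => -[->].
Qed.

Lemma enorm0 (m n : nat) : enorm (0 : 'M[R]_(m, n)) = 0.
Proof.
rewrite /enorm big1 ?sqrtr0// => i _; rewrite big1// => j _.
by rewrite mxE normr0 expr0n.
Qed.

Lemma ler_coord_enorm (m n : nat) (A : 'M[R]_(m, n)) i j : `|A i j| <= enorm A.
Proof.
rewrite -[leLHS]normr_id -sqrtr_sqr ler_sqrt ?sum_sqr_ge0//.
rewrite (bigD1 i)//= (bigD1 j)//= -addrA lerDl addr_ge0//.
  by apply: sumr_ge0 => k _; exact: sqr_ge0.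
by apply: sumr_ge0 => k _; apply: sumr_ge0 => l _; exact: sqr_ge0.
Qed.

End enorm.

Section holder.
Context (R : realType) (d : nat).
Implicit Type Q : set (phase R d).

(** On the scales [|v - v'| < 1/2] entering the seminorm, a Lipschitz function
    is Hoelder with the same constant. *)
Lemma holderv_lipschitz (V : zmodType) (nrm : V -> R) (alpha L : R) Q
    (h : phase R d -> V) : 0 < alpha < 1 -> 0 <= L ->
  (forall z w, pos z = pos w -> nrm (h z - h w) <= L * enorm (vel z - vel w)) ->
  (holderv nrm alpha Q h <= L%:E)%E.
Proof.
move=> /andP[a0 a1] L0 hL; apply: ge_ereal_sup => _ [z [w [_ _ _ pzw [/andP[e0 e1] ->]]]].
set e := enorm _ in e0 e1 *.
rewrite lee_fin ler_pdivrMr ?powR_gt0// (le_trans (hL _ _ pzw))// ler_wpM2l//.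
by rewrite -/e ger1_powR ?(ltW a1)// e0 /= (le_trans (ltW e1))// invf_le1// ler1n.
Qed.

(** For [0 < d] the cylinder contains admissible pairs of points, so that the
    supremum is over the set [{0}] and not over the empty set. *)
Lemma holderv_velocity_free (V : zmodType) (nrm : V -> R) (alpha : R)
    (h : phase R d -> V) : (0 < d)%N -> nrm 0 = 0 ->
  (forall z w, time z = time w -> pos z = pos w -> h z = h w) ->
  holderv nrm alpha (cyl 1) h = 0%E.
Proof.
move=> d0 n0 hE; rewrite /holderv.
rewrite (_ : [set s | _] = [set 0%E]) ?ereal_sup1//.
apply/seteqP; split => [_ [z [w [_ _ tzw pzw [_ ->]]]]|_ ->] /=.
  by rewrite (hE _ _ tzw pzw) subrr n0 mul0r.
pose i0 := Ordinal d0.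
pose w : phase R d := (0, 0, 4^-1 *: delta_mx 0 i0).
have e4 : enorm (4^-1 *: delta_mx 0 i0 : 'rV[R]_d) = 4^-1.
  rewrite (@enorm_single R _ _ _ 0 i0) ?mxE ?eqxx ?mulr1 ?ger0_norm// => i j.
  rewrite ord1 xpair_eqE eqxx /= => /negbTE ji.
  by rewrite !mxE ji andbF mulr0.
exists w, 0; rewrite /cyl /pos /vel /time /= enorm0 subr0 e4.
rewrite (hE w 0)//= subrr n0 mul0r !expr1n; split=> //.
- by split=> //; lra.
- by split=> //; lra.
- by split=> //; apply/andP; split; lra.
Qed.

Lemma null_set0 : Defs.null_set (set0 : set (phase R d)).
Proof.
move=> e e0; exists (fun=> 0), (fun=> 0); split=> //.
rewrite eseries0 ?lee_fin ?ltW// => k _ _.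
by rewrite mulr0 addn1 expr0n.
Qed.

Lemma Linfty_le Q (h : phase R d -> R) (M : R) : 0 <= M ->
  (forall z, Q z -> `|h z| <= M) -> (Linfty Q h <= M%:E)%E.
Proof.
move=> M0 hM; apply: ereal_inf_lbound; exists M => //; split=> //.
rewrite (_ : [set z | _] = set0); first exact: null_set0.
by rewrite -subset0 => z [/hM + hz]; rewrite leNgt hz.
Qed.

Lemma Linfty_ge0 Q (h : phase R d -> R) : (0 <= Linfty Q h)%E.
Proof. by apply: le_ereal_inf_tmp => _ [M [M0 _] <-]; rewrite lee_fin. Qed.

End holder.

(** * The oscillating solution *)

Section solution.
Context (R : realType) (d : nat) (i0 : 'I_d) (N : R) (N0 : 0 < N).

(** The stationary solution at frequency [N]; it depends on [x] and [v] only
    through their components of index [i0]. *)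
Definition sol (z : phase R d) : R :=
  N `^ (- (2 / 3)) * wave i0 N (N `^ (1 / 3)) 0 0 z.

(** The source term of [sol], independent of the velocity. *)
Definition source (z : phase R d) : R := cos (N * pos z 0 i0).

Let q := N `^ (1 / 3).
Let A := N `^ (- (2 / 3)).
Let W := wave i0 N q.

Let q_gt0 : 0 < q. Proof. exact: powR_gt0. Qed.

Let ampl_freq : A * N = q.
Proof.
rewrite /A /q -[X in _ * X](powRr1 (ltW N0)) -powRD; last by rewrite (gt_eqF N0) implybT.
by congr (_ `^ _); field.
Qed.

Let ampl_q2 : A * q ^+ 2 = 1.
Proof.
rewrite /A /q -powR_mulrn ?powR_ge0// -powRrM -powRD; last by rewrite (gt_eqF N0) implybT.
by rewrite (_ : - (2 / 3) + 1 / 3 * 2%:R = 0) ?powRr0//; field.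
Qed.

Let derive_scaled_wave (c : R) (n : nat) (theta : R) (e z : phase R d) :
  'D_e (fun z => c * W n theta z) z =
  c * (N * pos e 0 i0 * W n (theta + pi / 2) z
       + - (q * vel e 0 i0) * W n.+1 (theta + pi / 2) z).
Proof.
rewrite (@deriveZ _ _ _ (W n theta)); last exact: derivable_wave.
by rewrite -(congr1 (@^~ z) (@derive_wave R d i0 N q n theta e)).
Qed.

Let solE : sol = fun z => A * W 0 0 z. Proof. by []. Qed.

Lemma smooth_sol (Q : set (phase R d)) : smooth_on Q sol.
Proof.
exists setT, sol; split=> //; first exact: openT.
by move=> k; apply: Ck_on_scale; exact: Ck_on_wave.
Qed.

Lemma stationary_sol (Q : set (phase R d)) : stationary_on Q sol.
Proof. by move=> z w _ _ pzw vzw; rewrite /sol /wave pzw vzw. Qed.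

Lemma transport_sol (z : phase R d) :
  transport sol z = q * vel z 0 i0 * W 0 (pi / 2) z.
Proof.
rewrite /transport.
have -> : dt sol z = 0.
  rewrite /dt; under eq_fun do rewrite /sol /wave subrr mulr0.
  exact: lim_cst.
rewrite add0r (bigD1 i0)//= big1 ?addr0 => [|i ii0].
  rewrite solE derive_scaled_wave.
  rewrite /pos /vel /= !mxE !eqxx !mulr0 oppr0 mul0r addr0 add0r mulr1.
  by rewrite -ampl_freq; ring.
rewrite solE derive_scaled_wave.
by rewrite /pos /vel /= !mxE eqxx eq_sym (negbTE ii0) /= !(mulr0, mul0r, oppr0, addr0).
Qed.

Lemma hessv_sol (z : phase R d) i j :
  hessv sol z i j = (i == i0)%:R * (j == i0)%:R * W 2 pi z.
Proof.
rewrite mxE solE (_ : 'D_(@ev R d j) _ =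
   (fun z => - (A * q * (j == i0)%:R) * W 1 (0 + pi / 2) z)); last first.
  apply/funext => w; rewrite derive_scaled_wave /pos /vel /= !mxE eqxx /=.
  by rewrite (eq_sym i0); ring.
rewrite derive_scaled_wave /pos /vel /= !mxE eqxx /= mulr0 mul0r !add0r.
rewrite (_ : pi / 2 + pi / 2 = pi); last by field.
rewrite (eq_sym i0) -[RHS]mul1r -ampl_q2; ring.
Qed.

Lemma lapv_sol (z : phase R d) : lapv sol z = W 2 pi z.
Proof.
have lapE i : 'D_(@ev R d i) ('D_(@ev R d i) sol) z = hessv sol z i i by rewrite mxE.
rewrite /lapv (bigD1 i0)//= big1 ?addr0 => [|i ii0].
  by rewrite lapE hessv_sol eqxx !mul1r.
by rewrite lapE hessv_sol (negbTE ii0) !mul0r.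
Qed.

Lemma lapvE (f : phase R d -> R) (z : phase R d) : lapv f z = \tr (hessv f z).
Proof. by apply: eq_bigr => i _; rewrite mxE. Qed.

Lemma equation_sol (z : phase R d) : transport sol z = lapv sol z + source z.
Proof.
rewrite transport_sol lapv_sol /W /wave /source; exact: airy_ode.
Qed.

Lemma moment0 : moment R 0 = C0 R.
Proof. by apply: eq_Rintegral => s _; rewrite expr0 mul1r. Qed.

Lemma sol_le (z : phase R d) : `|sol z| <= C0 R * A.
Proof.
by rewrite normrM ger0_norm ?powR_ge0// mulrC ler_wpM2r ?powR_ge0// -moment0 airy_le.
Qed.

Lemma sol_lipschitz (z w : phase R d) : pos z = pos w ->
  `|sol z - sol w| <= A * (q * moment R 1) * enorm (vel z - vel w).
Proof.
move=> pzw; rewrite -mulrBr normrM ger0_norm ?powR_ge0// -mulrA ler_wpM2l ?powR_ge0//.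
rewrite (le_trans (wave_diff_le _ _ _ _ _ _ _))// pzw subrr normr0 mulr0 mul0r add0r.
rewrite mulrAC (gtr0_norm q_gt0) ler_wpM2l ?mulr_ge0 ?moment_ge0 ?(ltW q_gt0)//.
by have := ler_coord_enorm (vel z - vel w) 0 i0; rewrite !mxE.
Qed.

Lemma enorm_hessv_diff (z w : phase R d) :
  enorm (hessv sol z - hessv sol w) = `|W 2 pi z - W 2 pi w|.
Proof.
(* [hessv sol] is generalized so that rewriting does not unfold derivatives *)
move: (hessv sol) hessv_sol => H HE.
rewrite (@enorm_single R _ _ _ i0 i0) => [|i j].
  by rewrite !mxE !HE !eqxx !mul1r.
rewrite xpair_eqE negb_and !mxE !HE.
by move=> /orP[] /negbTE ->; rewrite !(mul0r, mulr0, subrr).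
Qed.

Lemma hessv_sol_lipschitz (z w : phase R d) : pos z = pos w ->
  enorm (hessv sol z - hessv sol w) <= q * moment R 3 * enorm (vel z - vel w).
Proof.
move=> pzw; rewrite enorm_hessv_diff.
rewrite (le_trans (wave_diff_le _ _ _ _ _ _ _))// pzw subrr normr0 mulr0 mul0r add0r.
rewrite mulrAC (gtr0_norm q_gt0) ler_wpM2l ?mulr_ge0 ?moment_ge0 ?(ltW q_gt0)//.
by have := ler_coord_enorm (vel z - vel w) 0 i0; rewrite !mxE.
Qed.

Lemma hessv_sol_le (z : phase R d) : enorm (hessv sol z) <= moment R 2.
Proof.
rewrite (@enorm_single R _ _ _ i0 i0) ?hessv_sol ?eqxx ?mul1r ?airy_le// => i j.
rewrite xpair_eqE negb_and hessv_sol.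
by move=> /orP[] /negbTE ->; rewrite !(mul0r, mulr0).
Qed.

(** Comparing the velocities [0] and [N^{-1/3}] in the direction [i0]; they lie
    in the ball of radius [1/2] as soon as [N >= 27]. *)
Lemma holder_hessv_sol_ge (alpha : R) : 27 <= N ->
  (((airy 2 pi 1 - airy 2 pi 0) * N `^ (alpha / 3))%:E
     <= holder_m alpha (cyl (1 / 2)) (hessv sol))%E.
Proof.
move=> N27.
have q3 : 3 <= q.
  have -> : (3 : R) = 27 `^ (1 / 3).
    have -> : (27 : R) = 3 ^+ 3 by rewrite -natrX.
    by rewrite -powR_mulrn// -powRrM (_ : 3%:R * (1 / 3) = 1 :> R) ?powRr1//; field.
  by rewrite /q ge0_ler_powR ?nnegrE//; lra.
pose w : phase R d := (0, 0, q^-1 *: delta_mx 0 i0).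
have qi3 : q^-1 <= 3^-1 by rewrite lef_pV2 ?posrE.
have qi0 : 0 < q^-1 by rewrite invr_gt0.
have ew : enorm (q^-1 *: delta_mx 0 i0 : 'rV[R]_d) = q^-1.
  rewrite (@enorm_single R _ _ _ 0 i0) ?mxE ?eqxx ?mulr1 ?gtr0_norm// => i j.
  rewrite ord1 xpair_eqE eqxx /= => /negbTE ji.
  by rewrite !mxE ji andbF mulr0.
have Ww : W 2 pi w = airy 2 pi 1.
  by rewrite /W /wave /w /pos /vel /= !mxE !eqxx !mulr1 mulr0 add0r divff ?gt_eqF.
have W0 : W 2 pi 0 = airy 2 pi 0.
  by rewrite /W /wave /pos /vel /= !mxE !mulr0 add0r.
apply: ereal_sup_ubound; exists w, 0; split.
- by rewrite /cyl /pos /vel /time /= enorm0 ew; split;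
    [rewrite lexx andbT oppr_lt0 exprn_gt0|rewrite exprn_gt0|]; lra.
- by rewrite /cyl /pos /vel /time /= !enorm0; split;
    [rewrite lexx andbT oppr_lt0 exprn_gt0|rewrite exprn_gt0|]; lra.
- by [].
- by [].
- rewrite {1 2}/w /vel /= subr0 ew; split; first by apply/andP; split; lra.
  rewrite enorm_hessv_diff Ww W0 (gtr0_norm (airy2_gap R)); congr (_ * _)%:E.
  rewrite -powRN -[X in _ = X `^ _]powR_inv1 ?(ltW q_gt0)// /q -!powRrM.
  by congr (_ `^ _); field.
Qed.

End solution.

(** * Failure of the velocity-only Schauder estimate *)

Lemma holder_source (R : realType) (d : nat) (i0 : 'I_d) (N alpha : R) :
  holder_r alpha (cyl 1) (source i0 N) = 0%E.
Proof.
apply: holderv_velocity_free; rewrite ?normr0//.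
  exact: leq_ltn_trans (ltn_ord i0).
by move=> z w _ pzw; rewrite /source pzw.
Qed.

Lemma mxle_scalar (R : realType) (d : nat) (a b : R) : a <= b ->
  mxle (a%:M : 'M[R]_d) b%:M.
Proof.
move=> ab xi; rewrite !mul_mx_scalar -!scalemxAl mxE [leRHS]mxE ler_wpM2r//.
by rewrite mxE sumr_ge0// => i _; rewrite mxE -expr2 sqr_ge0.
Qed.

(** [C] is an admissible constant in the velocity-only Schauder estimate with
    ellipticity [Lambda] and Hoelder exponent [alpha]. *)
Definition velocity_schauder (R : realType) (d : nat) (alpha Lambda C : R) :
    Prop :=
  forall (f : phase R d -> R) (a : phase R d -> 'M[R]_d)
         (c g : phase R d -> R),
    smooth_on (cyl 1) f ->
    (forall z, cyl 1 z ->
       transport f z = \tr (a z *m hessv f z) + c z * f z + g z) ->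
    (forall z, cyl 1 z ->
       [/\ mxle (Lambda^-1)%:M (a z), mxle (a z) Lambda%:M,
           `|c z| <= Lambda & `|g z| <= Lambda]) ->
    in_Cv_r alpha (cyl 1) f ->
    in_Cv_m alpha (cyl 1) (hessv f) ->
    in_Cv_m alpha (cyl 1) a ->
    in_Cv_r alpha (cyl 1) c ->
    in_Cv_r alpha (cyl 1) g ->
    (holder_m alpha (cyl (1 / 2)) (hessv f)
       <= C%:E * (1 + holder_r alpha (cyl 1) c
          + holder_m alpha (cyl 1) a `^ (1 + 2 / alpha))
               * Linfty (cyl 1) f
          + C%:E * (1 + holder_m alpha (cyl 1) a)
                 * holder_r alpha (cyl 1) g)%E.

Lemma not_velocity_schauder (R : realType) (d : nat) (alpha Lambda C : R) :
  (1 <= d)%N -> 0 < alpha < 1 -> 1 < Lambda ->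
  ~ @velocity_schauder R d alpha Lambda C.
Proof.
move=> hd halpha L1 HC.
have [a0 a1] := andP halpha.
pose i0 : 'I_d := Ordinal hd.
pose c0 : R := airy 2 pi 1 - airy 2 pi 0.
have c00 : 0 < c0 := airy2_gap R.
have C00 : 0 <= C0 R by rewrite -moment0 moment_ge0.
(* N so large that c0 N^(alpha/3) exceeds |C| C0, hence |C| C0 N^(-2/3) *)
pose X := (`|C| * C0 R + 1) / c0.
have X0 : 0 < X by rewrite divr_gt0// ltr_wpDl// mulr_ge0.
pose N := Num.max 27 (X `^ (3 / alpha)).
have N27 : 27 <= N by rewrite le_max lexx.
have N0 : 0 < N by apply: lt_le_trans N27.
have XN : X <= N `^ (alpha / 3).
  have -> : X = (X `^ (3 / alpha)) `^ (alpha / 3).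
    rewrite -powRrM (_ : 3 / alpha * (alpha / 3) = 1) ?powRr1 ?ltW//.
    by field; rewrite gt_eqF.
  rewrite ge0_ler_powR ?nnegrE ?powR_ge0 ?(ltW N0) ?(ltW (divr_gt0 a0 _))//.
  by rewrite le_max lexx orbT.
have A1 : N `^ (- (2 / 3)) <= 1.
  by rewrite -[leRHS](powRr0 N); apply: ler_powR; lra.
pose a := fun _ : phase R d => 1%:M : 'M[R]_d.
pose c := fun _ : phase R d => 0 : R.
have ha : holder_m alpha (cyl 1) a = 0%E.
  by apply: holderv_velocity_free; rewrite ?enorm0.
have hc : holder_r alpha (cyl 1) c = 0%E.
  by apply: holderv_velocity_free; rewrite ?normr0.
have := HC (sol i0 N) a c (source i0 N).
rewrite ha hc holder_source poweR0r ?gt_eqF ?addr_gt0 ?divr_gt0//.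
rewrite !adde0 mule1 mule0 adde0 => H.
have {H} : (holder_m alpha (cyl (1 / 2)) (hessv (sol i0 N))
   <= C%:E * Linfty (cyl 1) (sol i0 N))%E.
  apply: H.
  - exact: smooth_sol.
  - by move=> z _; rewrite /a /c mul1mx mul0r addr0 equation_sol// lapvE.
  - move=> z _; split.
    + by apply: mxle_scalar; rewrite invf_le1 ?ltW// (lt_trans _ L1).
    + by apply: mxle_scalar; exact: ltW.
    + by rewrite normr0 ltW// (lt_trans _ L1).
    + by rewrite (le_trans (cos_max _))// ltW.
  - split; first by exists (C0 R * N `^ (- (2 / 3))) => z _; exact: sol_le.
    apply: (le_lt_trans (holderv_lipschitz _ halpha _ (@sol_lipschitz _ _ i0 N N0))).
      by rewrite !mulr_ge0 ?powR_ge0 ?moment_ge0.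
    exact: ltry.
  - split; first by exists (moment R 2) => z _; exact: hessv_sol_le.
    apply: (le_lt_trans
      (holderv_lipschitz _ halpha _ (@hessv_sol_lipschitz _ _ i0 N N0))).
      by rewrite mulr_ge0 ?powR_ge0 ?moment_ge0.
    exact: ltry.
  - by split; [exists (enorm (1%:M : 'M[R]_d))|rewrite ha ltry].
  - by split; [exists 0 => z _; rewrite normr0|rewrite hc ltry].
  - by split; [exists 1 => z _; exact: cos_max|rewrite holder_source ltry].
apply/negP; rewrite -ltNge.
apply: lt_le_trans (holder_hessv_sol_ge i0 N0 alpha N27).
have solC : (Linfty (cyl 1) (sol i0 N) <= (C0 R)%:E)%E.
  apply: Linfty_le => // z _; rewrite (le_trans (sol_le _ _ _))//.
  by rewrite ler_piMr.
have L0 := Linfty_ge0 (cyl 1) (sol i0 N).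
apply: (@le_lt_trans _ _ (`|C| * C0 R)%:E).
  rewrite EFinM (@le_trans _ _ (`|C|%:E * Linfty (cyl 1) (sol i0 N))%E)//.
    by rewrite lee_wpmul2r// lee_fin ler_norm.
  by rewrite lee_wpmul2l// lee_fin.
rewrite lte_fin -/c0 -ltr_pdivrMl// mulrC; apply: lt_le_trans XN.
by rewrite ltr_pM2r ?invr_gt0// ltrDl.
Qed.

Theorem theorem2p1 (R : realType) (d : nat) (alpha : R)
    (hd : (1 <= d)%N) (halpha : 0 < alpha < 1) :
  [/\ C0 R = 3 `^ (- (2 / 3)) * Gamma (1 / 3),
      exists c0 N0 : R, [/\ 0 < c0, 1 <= N0 &
        forall N : R, N0 <= N ->
        exists g f : phase R d -> R,
          [/\ smooth_on (cyl 1) f,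
              stationary_on (cyl 1) f,
              forall z, cyl 1 z -> transport f z = lapv f z + g z,
              (Linfty (cyl 1) g <= 1)%E /\ holder_r alpha (cyl 1) g = 0%E &
              (Linfty (cyl 1) f <= (C0 R * N `^ (- (2 / 3)))%:E)%E /\
              ((c0 * N `^ (alpha / 3))%:E
                 <= holder_m alpha (cyl (1 / 2)) (hessv f))%E]] &
      forall Lambda : R, 1 < Lambda ->
        ~ exists C : R,
            forall (f : phase R d -> R) (a : phase R d -> 'M[R]_d)
                   (c g : phase R d -> R),
              smooth_on (cyl 1) f ->
              (forall z, cyl 1 z ->
                 transport f z = \tr (a z *m hessv f z) + c z * f z + g z) ->
              (forall z, cyl 1 z ->
                 [/\ mxle (Lambda^-1)%:M (a z), mxle (a z) Lambda%:M,
                     `|c z| <= Lambda & `|g z| <= Lambda]) ->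
              in_Cv_r alpha (cyl 1) f ->
              in_Cv_m alpha (cyl 1) (hessv f) ->
              in_Cv_m alpha (cyl 1) a ->
              in_Cv_r alpha (cyl 1) c ->
              in_Cv_r alpha (cyl 1) g ->
              (holder_m alpha (cyl (1 / 2)) (hessv f)
                 <= C%:E * (1 + holder_r alpha (cyl 1) c
                              + holder_m alpha (cyl 1) a `^ (1 + 2 / alpha))
                         * Linfty (cyl 1) f
                    + C%:E * (1 + holder_m alpha (cyl 1) a)
                           * holder_r alpha (cyl 1) g)%E].
Proof.
split.
- exact: C0_Gamma.
- exists (airy 2 pi 1 - airy 2 pi 0), 27; split; [exact: airy2_gap|by rewrite ler1n|].
  move=> N N27; have N0 : 0 < N by apply: lt_le_trans N27.
  pose i0 : 'I_d := Ordinal hd.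
  exists (source i0 N), (sol i0 N); split.
  + exact: smooth_sol.
  + exact: stationary_sol.
  + by move=> z _; exact: equation_sol.
  + split; last exact: holder_source.
    by apply: Linfty_le => // z _; exact: cos_max.
  + split; last exact: holder_hessv_sol_ge.
    apply: Linfty_le => [|z _]; last exact: sol_le.
    by rewrite mulr_ge0 ?powR_ge0// -moment0 moment_ge0.
- by move=> Lambda L1 [C]; exact: not_velocity_schauder.
Qed.
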